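(* Let $G$ be a finite connected graph, let $H$ be a subgraph of $G$ that is $P_3$-connected in $G$, and let $v\in V(G)$. Then at least one of the following holds: (1) there is a subgraph $H'$ of $G$ that is $P_3$-connected in $G$ with $H\subseteq H'$ (i.e. $V(H)\subseteq V(H')$ and $E(H)\subseteq E(H')$) and $v\in V(H')$; (2) there is a subgraph $H'$ of $G$ that is $P_3$-connected in $G$ with $v\in V(H')$ and containing a vertex $u\in V(H')$ such that $V(H)\subseteq V(H')$ and $uw\in E(H')$ for every $w\in V(H)$; (3) $v$ is adjacent to every vertex of $V(H)$.
   Context: Graphs are finite and simple. A subgraph $H$ of $G$ (not necessarily induced) is $P_3$-connected (in $G$) if $H$ is connected and for every two edges $e,f\in E(H)$ there is a sequence of edges $e=e_0,e_1,\dots,e_k=f$ of $H$ such that for each $0\le i\le k-1$, $e_i$ and $e_{i+1}$ are the two edges of an induced three-vertex path in $G$ (i.e. they share exactly one endpoint and their other endpoints are nonadjacent in $G$). *)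

(* Defs.v *)
From HB Require Import structures.
From mathcomp Require Import all_boot.

Set Implicit Arguments.
Unset Strict Implicit.
Unset Printing Implicit Defensive.

Record sgraph := SGraph {
  vertex :> finType;
  adj : rel vertex;
  adj_sym : symmetric adj;
  adj_irrefl : irreflexive adj
}.

Definition connected_graph (G : sgraph) : Prop :=
  forall x y : G, connect (@adj G) x y.

(* The edge xy is the two-element set [set x; y]. *)
Definition edges (G : sgraph) : {set {set G}} :=
  [set [set p.1; p.2] | p : G * G & adj p.1 p.2].

(* Not necessarily induced. *)
Record subgraph (G : sgraph) := Subgraph {
  sV : {set G};
  sE : {set {set G}};
  sE_edges : sE \subset edges G;
  sE_sV : forall e : {set G}, e \in sE -> e \subset sV
}.

Definition sadj (G : sgraph) (H : subgraph G) : rel G :=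
  [rel x y | [set x; y] \in sE H].

(* Paths for [sadj H] that start in [sV H] stay in [sV H] by [sE_sV].
   The empty subgraph counts as connected here. *)
Definition connected_subgraph (G : sgraph) (H : subgraph G) : Prop :=
  forall x y : G, x \in sV H -> y \in sV H -> connect (sadj H) x y.

(* e and f are the two edges of an induced path x - y - z of G; non-adjacency
   of x and z is tested in G, not in a subgraph. *)
Definition P3_step (G : sgraph) : rel {set G} :=
  [rel e f : {set G} | [exists x : G, exists y : G, exists z : G,
     [&& adj x y, adj y z, x != z, ~~ adj x z,
         e == [set x; y] & f == [set y; z]]]].

Definition P3_connected (G : sgraph) (H : subgraph G) : Prop :=
  connected_subgraph H /\
  forall e f : {set G}, e \in sE H -> f \in sE H ->
    connect [rel e1 e2 : {set G} |
               [&& e1 \in sE H, e2 \in sE H & P3_step e1 e2]] e f.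

(* Main.v *)
(** Induct on the distance from [v] to [V(H)]. A vertex at distance 1 that is
    not complete to [V(H)] sees exactly one end of some edge of [H], so it can
    be attached to [H] by a pendant edge. If it is complete to [V(H)], then,
    together with any of its neighbours at distance 2, it spans a
    [P3]-connected star over [V(H)]. In both cases the outermost edge joins
    consecutive distance layers, so it forms an induced path with any edge to
    the next layer, and the subgraph can be prolonged one layer at a time. *)

Require Import Defs.
From HB Require Import structures.
From mathcomp Require Import all_boot.

Set Implicit Arguments.
Unset Strict Implicit.
Unset Printing Implicit Defensive.

(** Serves both halves of [P3_connected]: once with vertices as points, once with edges as
    points. *)
Lemma connect_hub (T : finType) (e : rel T) (A : pred T) (h : T) :
  symmetric e -> (forall x, A x -> connect e x h) ->
  forall x y, A x -> A y -> connect e x y.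
Proof.
move=> e_sym hub x y /hub xh /hub yh.
by apply: connect_trans xh _; rewrite (sym_connect_sym e_sym).
Qed.

Lemma edges_adj (G : sgraph) (x y : G) : adj x y -> [set x; y] \in edges G.
Proof. by move=> xy; apply/imsetP; exists (x, y); rewrite ?inE. Qed.

Lemma adj_edges (G : sgraph) (x y : G) : [set x; y] \in edges G -> adj x y.
Proof.
case/imsetP=> -[a b]; rewrite inE /= => ab eq_e.
have [xe ye] : x \in [set a; b] /\ y \in [set a; b].
  by rewrite -eq_e !inE !eqxx orbT.
have ab_neq : a != b by apply: contraTneq ab => ->; rewrite adj_irrefl.
(* Two elements force [x] and [y] to be distinct, hence to be [a] and [b] in some order. *)
have: #|[set x; y]| = 2 by rewrite eq_e cards2 ab_neq.
rewrite cards2; case: eqP => // + _.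
by case/set2P: xe => ->; case/set2P: ye => -> //; rewrite adj_sym.
Qed.

Lemma sadj_adj (G : sgraph) (K : subgraph G) (x y : G) : sadj K x y -> adj x y.
Proof. by move/(subsetP (sE_edges K))/adj_edges. Qed.

Lemma sadj_sym (G : sgraph) (K : subgraph G) : symmetric (sadj K).
Proof. by move=> x y; rewrite /sadj /= setUC. Qed.

Lemma P3_stepI (G : sgraph) (x y z : G) :
  adj x y -> adj y z -> x != z -> ~~ adj x z ->
  P3_step [set x; y] [set y; z].
Proof.
move=> xy yz xz nxz; apply/existsP; exists x; apply/existsP; exists y.
by apply/existsP; exists z; rewrite xy yz xz nxz !eqxx.
Qed.

Lemma P3_step_sym (G : sgraph) : symmetric (@P3_step G).
Proof.
have imp (e f : {set G}) : P3_step e f -> P3_step f e.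
  case/existsP=> x /existsP[y /existsP[z /and5P[xy yz xz nxz]]].
  case/andP=> /eqP-> /eqP->.
  rewrite (setUC [set x]) (setUC [set y]).
  by apply: P3_stepI; rewrite ?(eq_sym z) // adj_sym.
by move=> e f; apply/idP/idP; apply: imp.
Qed.

(** The anonymous relation inside [P3_connected], named so that its symmetry can be stated. *)
Definition P3_rel (G : sgraph) (K : subgraph G) : rel {set G} :=
  [rel e f : {set G} | [&& e \in sE K, f \in sE K & P3_step e f]].

Lemma P3_rel_sym (G : sgraph) (K : subgraph G) : symmetric (P3_rel K).
Proof. by move=> e f; rewrite /P3_rel /= P3_step_sym andbCA. Qed.

Section Pendant.

Variables (G : sgraph) (K : subgraph G) (x a : G).
Hypotheses (xa : adj x a) (aK : a \in sV K).

Lemma pendant_edges : [set x; a] |: sE K \subset edges G.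
Proof. by rewrite subUset sub1set edges_adj ?sE_edges. Qed.

Lemma pendant_sV (e : {set G}) : e \in [set x; a] |: sE K -> e \subset x |: sV K.
Proof.
case/setU1P=> [->|/sE_sV eK]; last exact: subset_trans eK (subsetUr _ _).
by rewrite setUS // sub1set.
Qed.

Definition pendant : subgraph G := Subgraph pendant_edges pendant_sV.

(** The path [x] - [a] - [b] is induced, so the new edge is one step from [[set a; b]], which every
    edge of [K] already reaches inside [K]. *)
Lemma pendant_P3_connected (b : G) :
  P3_connected K -> sadj K a b -> x != b -> ~~ adj x b -> P3_connected pendant.
Proof.
move=> [connK P3K] ab xb nxb; split.
  apply: (@connect_hub _ _ _ a) (sadj_sym _) _ => y /setU1P[->|yK].
    by apply: connect1; rewrite /sadj /= setU11.
  apply: connect_sub (connK _ _ yK aK) => s t st.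
  by apply: connect1; rewrite /sadj /= setU1r.
apply: (@connect_hub _ _ (mem (sE pendant)) [set a; b]) (P3_rel_sym _) _.
move=> e /setU1P[->|eK].
  apply: connect1; rewrite /P3_rel /= setU11 setU1r //=.
  exact: P3_stepI (sadj_adj ab) _ _.
apply: connect_sub (P3K _ _ eK ab) => s t /and3P[sK tK st].
by apply: connect1; rewrite /P3_rel /= !setU1r.
Qed.

End Pendant.

Section Star.

Variables (G : sgraph) (u : G) (L : {set G}).
Hypothesis uL : forall w, w \in L -> adj u w.

Lemma star_edges : [set [set u; w] | w in L] \subset edges G.
Proof. by apply/subsetP=> _ /imsetP[w /uL uw ->]; apply: edges_adj. Qed.

Lemma star_sV (e : {set G}) : e \in [set [set u; w] | w in L] -> e \subset u |: L.
Proof. by case/imsetP=> w wL ->; rewrite setUS // sub1set. Qed.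

Definition star : subgraph G := Subgraph star_edges star_sV.

Lemma sadj_star (w : G) : w \in L -> sadj star u w.
Proof. by move=> wL; apply/imsetP; exists w. Qed.

(** For each leaf [w] other than [z], the path [w] - [u] - [z] is induced, so every edge is at most
    one step from the edge at [z]. *)
Lemma star_P3_connected (z : G) :
  z \in L -> (forall w, w \in L -> ~~ adj z w) -> P3_connected star.
Proof.
move=> zL nzL; split.
  apply: (@connect_hub _ _ _ u) (sadj_sym _) _ => y /setU1P[->//|yL].
  by rewrite connect1 // sadj_sym sadj_star.
apply: (@connect_hub _ _ (mem (sE star)) [set u; z]) (P3_rel_sym _) _.
move=> _ /imsetP[w wL ->]; have [->//|wz] := eqVneq w z.
apply: connect1; apply/and3P; split; try exact: sadj_star.
by rewrite setUC; apply: P3_stepI; rewrite ?uL // adj_sym ?uL ?nzL.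
Qed.

End Star.

(** A path of [K] from [x] to [y] must leave [A] along some edge. *)
Lemma connected_boundary (G : sgraph) (K : subgraph G) (A : pred G) (x y : G) :
  connected_subgraph K -> x \in sV K -> y \in sV K -> A x -> ~~ A y ->
  exists a b, [/\ sadj K a b, A a & ~~ A b].
Proof.
move=> connK xK yK Ax nAy; case/connectP: (connK _ _ xK yK) nAy => p + ->.
elim: p x Ax {xK} => [|b p IHp] x Ax /=; first by rewrite Ax.
case/andP=> xb pathp; case: (boolP (A b)) => [Ab|nAb _]; last by exists x, b.
exact: IHp.
Qed.

(** Closed ball: the vertices at distance at most [n] from [S]. Distance layers are differences of
    consecutive balls. *)
Fixpoint ball (G : sgraph) (S : {set G}) (n : nat) : {set G} :=
  if n is m.+1 then
    ball S m :|: [set y | [exists x in ball S m, adj x y]]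
  else S.

Lemma ballS_adj (G : sgraph) (S : {set G}) n (x y : G) :
  x \in ball S n -> adj x y -> y \in ball S n.+1.
Proof.
by move=> xS xy; rewrite !inE; apply/orP; right; apply/existsP; exists x; apply/andP.
Qed.

Lemma ball_layer (G : sgraph) (S : {set G}) n (y : G) :
  y \in ball S n.+1 -> y \notin ball S n ->
  exists2 x, x \in ball S n & adj x y.
Proof. by rewrite /= !inE => /orP[->//|/existsP[x /andP[xS xy]] _]; exists x. Qed.

Lemma ball_connected (G : sgraph) (S : {set G}) (x v : G) :
  connected_graph G -> x \in S -> exists n, v \in ball S n.
Proof.
move=> /(_ x v) /connectP[p + ->] xS; have: x \in ball S 0 by [].
(* The radius is generalised with the start, as each edge of the path costs one. *)
elim: p x 0 {xS} => [|y p IHp] x n xB /=; first by exists n.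
by case/andP=> /(ballS_adj xB)/IHp.
Qed.

(** What outcomes (1) and (2) say about [H], leaving [v] aside; it survives enlarging [K], so both
    outcomes are prolonged together. *)
Definition extends_or_cones (G : sgraph) (H K : subgraph G) : Prop :=
  sV H \subset sV K /\
  (sE H \subset sE K \/
   exists2 u, u \in sV K & forall w, w \in sV H -> [set u; w] \in sE K).

Lemma extends_or_cones_sub (G : sgraph) (H K K' : subgraph G) :
  sV K \subset sV K' -> sE K \subset sE K' ->
  extends_or_cones H K -> extends_or_cones H K'.
Proof.
move=> sVK sEK [HV HK]; split; first exact: subset_trans sVK.
case: HK => [HE|[u uK uH]]; [left; exact: subset_trans sEK | right].
by exists u => [|w /uH]; [apply: subsetP uK | apply: subsetP].
Qed.

(** The edge from [v] to [a] in the smaller ball is the induction invariant: a vertex of the next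
    layer cannot be adjacent to [a]. *)
Lemma layer_extends_or_cones (G : sgraph) (H : subgraph G) n (v : G) :
  P3_connected H -> v \in ball (sV H) n.+1 -> v \notin ball (sV H) n ->
  (exists K : subgraph G, [/\ P3_connected K, extends_or_cones H K &
     exists2 a, a \in ball (sV H) n & sadj K v a])
  \/ (n = 0 /\ forall w, w \in sV H -> adj v w).
Proof.
move=> P3H; elim: n v => [|n IHn] v vB vNB.
  have [x xH xv] := ball_layer vB vNB.
  have [/forall_inP vH|] := boolP [forall w in sV H, adj v w].
    by right; split.
  rewrite negb_forall => /existsP[y]; rewrite negb_imply => /andP[yH nvy].
  have vx : adj v x by rewrite adj_sym.
  (* Since [v] sees [x] but not [y], some edge of [H] leaves its neighbourhood. *)
  have [a [b [ab va nvb]]] := connected_boundary P3H.1 xH yH vx nvy.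
  have /subsetP abH := sE_sV ab.
  have aH : a \in sV H by rewrite abH ?set21.
  have bH : b \in sV H by rewrite abH ?set22.
  have vb : v != b by apply: contraNneq vNB => ->.
  left; exists (pendant va aH); split.
  - exact: pendant_P3_connected nvb.
  - by split; [apply: subsetUr | left; apply: subsetUr].
  - by exists a => //; apply: setU11.
have [x xB xv] := ball_layer vB vNB.
have xNB : x \notin ball (sV H) n.
  by apply: contra vNB => /ballS_adj; apply.
have vx : adj v x by rewrite adj_sym.
have farv w : w \in ball (sV H) n -> ~~ adj v w.
  by move=> wB; apply: contra vNB; rewrite adj_sym; apply: ballS_adj.
left; case: (IHn x xB xNB) => [[K [P3K HK [a aB xa]]]|[n0 xH]].
  have xK : x \in sV K by apply: subsetP (sE_sV xa) _ _; rewrite set21.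
  have va : v != a by apply: contraNneq vNB => ->; rewrite inE aB.
  exists (pendant vx xK); split.
  - exact: pendant_P3_connected P3K xa va (farv a aB).
  - by apply: extends_or_cones_sub HK; apply: subsetUr.
  - by exists x => //; apply: setU11.
(* Now [x] is complete to [V(H)] and [v] is at distance 2: in the star at [x] over [V(H)] and [v],
   the leaf [v] is nonadjacent to all leaves. *)
rewrite n0 /= in farv.
have xL w : w \in v |: sV H -> adj x w by case/setU1P=> [->|/xH].
exists (star xL); split.
- apply: (@star_P3_connected _ _ _ _ v); first exact: setU11.
  by move=> w /setU1P[->|/farv//]; rewrite adj_irrefl.
- split; first by rewrite /= setUA subsetUr.
  right; exists x => [|w wH]; first exact: setU11.
  by apply: sadj_star; apply: setU1r.
- by exists x => //; rewrite sadj_sym sadj_star // setU11.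
Qed.

Theorem theorem4p2 (G : sgraph) (H : subgraph G) (v : G) :
  connected_graph G ->
  P3_connected H ->
  (exists H' : subgraph G,
     [/\ P3_connected H', sV H \subset sV H', sE H \subset sE H'
       & v \in sV H'])
  \/
  (exists H' : subgraph G,
     [/\ P3_connected H', v \in sV H', sV H \subset sV H'
       & exists2 u : G, u \in sV H' &
           forall w : G, w \in sV H -> [set u; w] \in sE H'])
  \/
  (forall w : G, w \in sV H -> adj v w).
Proof.
move=> connG P3H.
(* For empty [V(H)], outcome (3) is vacuous. *)
have [H0|[x xH]] := set_0Vmem (sV H).
  by right; right=> w; rewrite H0 inE.
have exB := ball_connected v connG xH.
(* The least radius is the distance from [v] to [V(H)]; at radius 0, [H] itself contains [v]. *)
case: (ex_minnP exB) => -[|n] vB minB.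
  by left; exists H; split.
have vNB : v \notin ball (sV H) n.
  by apply/negP=> /minB; rewrite ltnn.
case: (layer_extends_or_cones P3H vB vNB) => [|[_ vH]]; last by right; right.
case=> K [P3K [HV HK] [a _ va]].
have vK : v \in sV K by apply: subsetP (sE_sV va) _ _; rewrite set21.
by case: HK => HK; [left | right; left]; exists K.
Qed.
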